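(* Consider the synchronous zero-temperature dynamics $\sigma^n$, $n\in\{0,1,2,\dots\}$, on the hexagonal lattice $\mathbb{H}$ with initial density $\lambda$ of $+1$ spins. For every $\lambda\in[0,1]$, $\sigma^n$ converges to $\sigma^\infty$ exponentially fast in the sense that there is a constant $c\in(0,\infty)$ such that for all $n\ge 0$ $$\tilde p^{\mathcal{A}}(n)\le e^{-cn}\quad\text{and}\quad \tilde p^{\mathcal{B}}(n)\le e^{-cn},$$ where $\tilde p^{\mathcal{A}}(n)$ (resp., $\tilde p^{\mathcal{B}}(n)$) is the probability that a given deterministic site in the sublattice $\mathcal{A}$ (resp., $\mathcal{B}$) flips after time $n$.
   Context: $\mathbb{H}$ is the hexagonal (honeycomb) lattice in the plane, viewed as a graph in which each site has exactly three nearest neighbors. It is bipartite: it is partitioned into two sublattices $\mathcal{A}$ and $\mathcal{B}$ (with the origin in $\mathcal{B}$) such that all three neighbors of any site in $\mathcal{A}$ (resp., $\mathcal{B}$) are in $\mathcal{B}$ (resp., $\mathcal{A}$). The synchronous dynamics for the homogeneous ferromagnet is the discrete time process $\sigma^n\in\{-1,+1\}^{\mathbb{H}}$, $n=0,1,2,\dots$, defined as follows. The initial spins $\sigma^0_x$ are i.i.d. with $P_{\sigma^0}(\sigma^0_x=+1)=\lambda$ and $P_{\sigma^0}(\sigma^0_x=-1)=1-\lambda$. At odd times $n=1,3,5,\dots$ all sites of $\mathcal{A}$ are updated simultaneously, and at even times $n=2,4,6,\dots$ all sites of $\mathcal{B}$ are updated simultaneously; when a site is updated, its spin flips if it agrees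 with fewer than half of the spins of its three neighbors, and otherwise it does not flip (so after the update it equals the majority spin of its three neighbors). Sites of the other sublattice keep their values. $\sigma^\infty=\lim_{n\to\infty}\sigma^n$. A site flips after time $n$ if its spin flips at some update time $m>n$. Probability is with respect to $P_{\sigma^0}$; by translation invariance it does not depend on the chosen site within a sublattice. *)

(* Defs.v *)
From mathcomp Require Import all_boot all_order all_algebra.
From mathcomp Require Import all_classical all_reals all_analysis.
From mathcomp Require Import zify.

Set Implicit Arguments.
Unset Strict Implicit.
Unset Printing Implicit Defensive.

Import Order.TTheory GRing.Theory Num.Theory.

Local Open Scope classical_set_scope.
Local Open Scope ring_scope.

(* Honeycomb lattice. Let e1, e2, e3 be unit vectors of the plane at mutual
   angles of 120 degrees, a1 = e1 - e2 and a2 = e1 - e3. The site (b, i, j) is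
   the point i a1 + j a2 + (if b then e1 else 0), so b = true is the sublattice
   A, b = false is the sublattice B, and the origin (false, 0, 0) is in B. The
   neighbours of a site of B are its translates by e1, e2 = e1 - a1 and
   e3 = e1 - a2; those of a site of A are its translates by -e1, -e2, -e3. *)
Definition site : Type := (bool * int * int)%type.

Definition subA : set site := [set x | x.1.1 = true].
Definition subB : set site := [set x | x.1.1 = false].

Definition neighbors (x : site) : seq site :=
  let: (b, i, j) := x in
  if b then [:: (false, i, j); (false, i + 1, j); (false, i, j + 1)]
  else [:: (true, i, j); (true, i - 1, j); (true, i, j - 1)].

Lemma neighbors_sym (x y : site) : (y \in neighbors x) = (x \in neighbors y).
Proof.
by case: x y => [[[] i] j] [[[] k] l]; rewrite /= !inE !xpair_eqE /=; lia.
Qed.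

Lemma neighbors_subA (x y : site) : y \in neighbors x -> subA x <-> subB y.
Proof.
by case: x y => [[[] i] j] [[[] k] l]; rewrite /= !inE !xpair_eqE.
Qed.

Lemma neighbors_uniq (x : site) : uniq (neighbors x) /\ size (neighbors x) = 3%N.
Proof.
by case: x => [[[] i] j]; split; rewrite //= !inE !xpair_eqE /=; lia.
Qed.

(* Spins are Booleans: true is +1 and false is -1. *)
Definition config : Type := site -> bool.

Definition agreeing (s : config) (x : site) : nat :=
  count (fun y => s y == s x) (neighbors x).

Definition update (s : config) (x : site) : bool :=
  if (2 * agreeing s x < size (neighbors x))%N then ~~ s x else s x.

(* The sublattice A (b = true) is updated at odd times, B at even times. *)
Fixpoint sync (s : config) (n : nat) : config :=
  if n is m.+1 then
    fun x => if x.1.1 == odd n then update (sync s m) x else sync s m x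
  else s.

Lemma update_majority (s : config) (x : site) :
  update s x = (2 <= count s (neighbors x))%N.
Proof.
rewrite /update /agreeing; case: x => [[[] i] j] /=;
  by case: (s _); case: (s _); case: (s _); case: (s _).
Qed.

Definition sync_infty (s : config) : config :=
  fun x => lim (sync s n x @[n --> \oo]).

Definition flips_after (n : nat) (x : site) : set config :=
  [set s | exists m, (n < m)%N /\ sync s m x != sync s m.-1 x].

Definition mutually_independent d (T : measurableType d) (R : realType)
    (P : probability T R) (I : eqType) (X : I -> {RV P >-> bool}) : Prop :=
  forall (J : seq I) (B : I -> set bool), uniq J ->
    P (\bigcap_(i in [set` J]) (X i @^-1` B i)) =
    (\prod_(i <- J) P (X i @^-1` B i))%E.

Definition iid_spins d (T : measurableType d) (R : realType)
    (P : probability T R) (lambda : R) (X : site -> {RV P >-> bool}) : Prop :=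
  mutually_independent X /\
  forall x, P (X x @^-1` [set true]) = lambda%:E /\
            P (X x @^-1` [set false]) = (1 - lambda)%:E.

(* Main.v *)
(* Restricted to B, two successive updates define a majority dynamics on a
   triangular lattice. Whenever a vertex flips, the down triangle it then forms
   with two neighbours is constant, and constant down triangles never change: each
   vertex flips at most once, so the dynamics converges for every initial
   configuration.
   A flip from b to -b at step k goes back to a flip from b to -b of a neighbour
   at step k - 1, and so on. These vertices all had spin b initially; they form an
   induced path, so that there are only three choices for each new vertex; and the
   third vertex of the down triangle of each edge of the path had spin -b
   initially, for otherwise the edge would be stable. These third vertices are
   distinct, except that those of two edges at distance two coincide when the path
   bends around them. The sum over all such paths is governed by a 2 x 2 transfer
   matrix with entries pq, 2pq and p + pq, where p and q = 1 - p are the densities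
   of b and -b; its spectral radius is at most 7/8.
   To remove the multiplicative constant, note that a fixed down triangle is
   constant initially with probability at least 1/8. *)

Require Import Defs.
From mathcomp Require Import all_boot all_order all_algebra.
From mathcomp Require Import all_classical all_reals all_analysis.
From mathcomp Require Import zify ring lra.

Set Implicit Arguments.
Unset Strict Implicit.
Unset Printing Implicit Defensive.

Import Order.TTheory GRing.Theory Num.Theory.

Local Open Scope classical_set_scope.
Local Open Scope ring_scope.

Notation vertex := (int * int)%type.

(** * The dynamics as a process on the triangular lattice B *)

Ltac geo := by [|rewrite ?inE /= ?xpair_eqE; lia].

(* A vertex (i, j) stands for the site (false, i, j) of B. The sites of B form a
   triangular lattice whose triangles are the [up a], the neighbourhoods of the
   sites (true, a) of A, and the [down a]. *)
Definition spinB (s : config) (k : nat) (v : vertex) : bool :=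
  sync s k.*2 (false, v.1, v.2).
Definition spinA (s : config) (k : nat) (a : vertex) : bool :=
  sync s k.*2.+1 (true, a.1, a.2).

Definition up (a : vertex) : seq vertex :=
  [:: a; (a.1 + 1, a.2); (a.1, a.2 + 1)].
Definition down (a : vertex) : seq vertex :=
  [:: (a.1 + 1, a.2); (a.1, a.2 + 1); (a.1 + 1, a.2 + 1)].

Lemma syncS s n x : sync s n.+1 x =
  if x.1.1 == ~~ odd n then update (sync s n) x else sync s n x.
Proof. by []. Qed.

Lemma spinAE s k a : spinA s k a = (1 < count (spinB s k) (up a))%N.
Proof. by rewrite /spinA syncS odd_double update_majority. Qed.

Lemma syncA_even s k a : sync s k.+1.*2 (true, a.1, a.2) = spinA s k a.
Proof. by rewrite doubleS syncS oddS odd_double. Qed.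

Lemma syncB_odd s k v : sync s k.*2.+1 (false, v.1, v.2) = spinB s k v.
Proof. by rewrite syncS odd_double. Qed.

Lemma sync_spinA s n a : sync s n.+1 (true, a.1, a.2) = spinA s n./2 a.
Proof.
rewrite -{1}(odd_double_half n); case: (odd n); last by [].
by rewrite add1n -doubleS syncA_even.
Qed.

Lemma sync_spinB s n v : sync s n (false, v.1, v.2) = spinB s n./2 v.
Proof.
rewrite -{1}(odd_double_half n); case: (odd n); last by [].
by rewrite add1n syncB_odd.
Qed.

Lemma spinBS s k i j : spinB s k.+1 (i, j) =
  (1 < count (spinA s k) [:: (i, j); (i - 1, j); (i, j - 1)]%R)%N.
Proof. by rewrite /spinB doubleS syncS oddS odd_double update_majority. Qed.

Lemma two_of_three (T : eqType) (f : pred T) (l : seq T) (b : bool) (x y : T) :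
  size l = 3%N -> x \in l -> y \in l -> x != y -> f x = b -> f y = b ->
  (1 < count f l)%N = b.
Proof.
case: l => [|p [|q [|r [|? ?]]]] //= _; rewrite !inE.
move=> /or3P[]/eqP-> /or3P[]/eqP->; rewrite ?eqxx // => _; 
  case: b; case: (f p); case: (f q); case: (f r) => //.
Qed.

Lemma one_of_three (T : eqType) (f : pred T) (l : seq T) (b : bool) (x y : T) :
  size l = 3%N -> x \in l -> y \in l -> x != y -> f x = ~~ b ->
  (1 < count f l)%N = b -> f y = b.
Proof.
move=> sl xl yl xy fx cb; apply: contraPP cb => fy; apply/eqP.
have fy' : f y = ~~ b by move/eqP: fy; case: (f y); case: b {fx}.
by rewrite (two_of_three sl xl yl xy fx fy'); case: b {fx fy fy'}.
Qed.

Lemma mem_up a i j :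
  ((i, j) \in up a) = (a \in [:: (i, j); (i - 1, j); (i, j - 1)]).
Proof. by case: a => p q; rewrite /up !inE !xpair_eqE /=; lia. Qed.

Lemma spinA_two s k a b u v : u \in up a -> v \in up a -> u != v ->
  spinB s k u = b -> spinB s k v = b -> spinA s k a = b.
Proof. by rewrite spinAE; apply: two_of_three. Qed.

Lemma spinA_one s k a b u v : u \in up a -> v \in up a -> u != v ->
  spinB s k u = ~~ b -> spinA s k a = b -> spinB s k v = b.
Proof. by rewrite spinAE; apply: one_of_three. Qed.

Lemma spinB_two s k v b a c : v \in up a -> v \in up c -> a != c ->
  spinA s k a = b -> spinA s k c = b -> spinB s k.+1 v = b.
Proof. by case: v => i j; rewrite !mem_up spinBS; apply: two_of_three. Qed.

Lemma spinB_one s k v b a c : v \in up a -> v \in up c -> a != c ->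
  spinA s k a = ~~ b -> spinB s k.+1 v = b -> spinA s k c = b.
Proof. by case: v => i j; rewrite !mem_up spinBS; apply: one_of_three. Qed.

(** Each side of a down triangle lies in an up triangle, so three A-sites take the spin b, and every
    vertex of the down triangle is next to two of them. *)
Lemma down_step s k a b : {in down a, forall v, spinB s k v = b} ->
  {in down a, forall v, spinB s k.+1 v = b}.
Proof.
case: a => i j dn.
have d1 : spinB s k (i + 1, j) = b by apply: dn; rewrite !inE eqxx.
have d2 : spinB s k (i, j + 1) = b by apply: dn; rewrite !inE eqxx orbT.
have d3 : spinB s k (i + 1, j + 1) = b by apply: dn; rewrite !inE eqxx !orbT.
have t0 : spinA s k (i, j) = b.
  apply: spinA_two d1 d2; geo.
have t1 : spinA s k (i + 1, j) = b.
  apply: spinA_two d1 d3; geo.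
have t2 : spinA s k (i, j + 1) = b.
  apply: spinA_two d2 d3; geo.
move=> v; rewrite !inE => /or3P[]/eqP->.
- apply: spinB_two t0 t1; geo.
- apply: spinB_two t0 t2; geo.
- apply: spinB_two t1 t2; geo.
Qed.

Lemma down_stable s k a b : {in down a, forall v, spinB s k v = b} ->
  forall m, (k <= m)%N -> {in down a, forall v, spinB s m v = b}.
Proof.
move=> dn m /subnKC <-; elim: (m - k)%N => [|n IHn]; first by rewrite addn0.
by rewrite addnS; apply: down_step.
Qed.

Lemma spinB_maj s k i j b : spinB s k.+1 (i, j) = b ->
  [\/ spinA s k (i, j) = b /\ spinA s k (i - 1, j) = b,
      spinA s k (i - 1, j) = b /\ spinA s k (i, j - 1) = b |
      spinA s k (i, j - 1) = b /\ spinA s k (i, j) = b].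
Proof.
rewrite spinBS /=; case: (spinA _ _ (i, j)); case: (spinA _ _ (i - 1, j));
  case: (spinA _ _ (i, j - 1)) => /= <-; by [left|right; left|right; right
    |constructor 1|constructor 2|constructor 3].
Qed.

(* A flip takes place next to two A-sites that agree with the new spin, hence
   next to four consecutive triangular neighbours with that spin; the middle two
   span a down triangle with v and cannot flip at the same time. *)
Lemma flip_down s k v b : spinB s k v = ~~ b -> spinB s k.+1 v = b ->
  exists2 a, v \in down a & {in down a, forall u, spinB s k.+1 u = b}.
Proof.
case: v => i j vk vk1.
(* As v dissents with spin -b, an A-site next to it with spin b needs b at both its other
   vertices. *)
have nbr a u : (i, j) \in up a -> u \in up a -> (i, j) != u ->
    spinA s k a = b -> spinB s k u = b.
  by move=> ia ua iu; apply: spinA_one vk.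
case: (spinB_maj vk1) => -[ta tc].
- have h1 : spinB s k (i, j + 1) = b.
    apply: (nbr (i, j)); geo.
  have h2 : spinB s k (i - 1, j + 1) = b.
    apply: (nbr (i - 1, j)); geo.
  have t : spinA s k (i - 1, j + 1) = b.
    apply: spinA_two h1 h2; geo.
  exists (i - 1, j) => [|u]; first geo; rewrite !inE /=.
  rewrite subrK => /or3P[]/eqP-> //.
  + apply: spinB_two tc t; geo.
  + apply: spinB_two ta t; geo.
- have h1 : spinB s k (i - 1, j) = b.
    apply: (nbr (i - 1, j)); geo.
  have h2 : spinB s k (i, j - 1) = b.
    apply: (nbr (i, j - 1)); geo.
  have t : spinA s k (i - 1, j - 1) = b.
    apply: spinA_two h1 h2; geo.
  exists (i - 1, j - 1) => [|u]; first geo; rewrite !inE /=.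
  rewrite !subrK => /or3P[]/eqP-> //.
  + apply: spinB_two tc t; geo.
  + apply: spinB_two ta t; geo.
- have h1 : spinB s k (i + 1, j - 1) = b.
    apply: (nbr (i, j - 1)); geo.
  have h2 : spinB s k (i + 1, j) = b.
    apply: (nbr (i, j)); geo.
  have t : spinA s k (i + 1, j - 1) = b.
    apply: spinA_two h1 h2; geo.
  exists (i, j - 1) => [|u]; first geo; rewrite !inE /=.
  rewrite !subrK => /or3P[]/eqP-> //.
  + apply: spinB_two ta t; geo.
  + apply: spinB_two tc t; geo.
Qed.

Lemma flip_stable s k v : spinB s k v != spinB s k.+1 v ->
  forall m, (k < m)%N -> spinB s m v = spinB s k.+1 v.
Proof.
move=> vk m km.
have [a va dn] : exists2 a, v \in down a &
    {in down a, forall u, spinB s k.+1 u = spinB s k.+1 v}.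
  by apply: flip_down => //; move: vk; do 2![case: (spinB _ _ v)].
exact: (down_stable dn km).
Qed.

(** An earlier flip would freeze v by [flip_stable] and rule out the flip at step k. *)
Lemma flip_before s k v : spinB s k v != spinB s k.+1 v ->
  forall m, (m <= k)%N -> spinB s m v = spinB s k v.
Proof.
move=> vk m mk; rewrite -(subnKC mk).
have : (m + (k - m) <= k)%N by rewrite subnKC.
elim: (k - m)%N => [|n IHn]; rewrite ?addn0 // addnS => nk.
rewrite IHn 1?ltnW //; apply: contraTeq vk => /flip_stable st.
by rewrite !st ?eqxx // ltnW.
Qed.

(** * Chains of flips *)

Lemma bool_neqN (b : bool) : b <> ~~ b.
Proof. by case: b. Qed.

Definition flips s b k v := spinB s k v = b /\ spinB s k.+1 v = ~~ b.

Lemma flips_spin_after s b k v : flips s b k v ->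
  forall m, (k < m)%N -> spinB s m v = ~~ b.
Proof.
case=> vk vk1 m km; rewrite (@flip_stable s k) // vk vk1; by case: b {vk vk1}.
Qed.

Lemma flips_spin_before s b k v : flips s b k v ->
  forall m, (m <= k)%N -> spinB s m v = b.
Proof.
case=> vk vk1 m km; rewrite (@flip_before s k) // vk vk1; by case: b {vk vk1}.
Qed.

Lemma flips_not_down s b k v a m : flips s b k v -> v \in down a ->
  ~ {in down a, forall u, spinB s m u = b}.
Proof.
move=> fv va dn; have := flips_spin_after fv (ltn_addr m (ltnSn k)).
rewrite (down_stable dn _ va) ?leq_addl //.
exact: bool_neqN.
Qed.

(** How a flip of y at step k reaches x at step k + 1: an A-site next to both changes its spin in
    between. *)
Definition link s b k (x y : vertex) : Prop := exists a,
  [/\ x \in up a, y \in up a, x != y, spinA s k a = b & spinA s k.+1 a = ~~ b].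

Lemma majority_change (T : eqType) (f g : pred T) (l : seq T) (b : bool) :
  size l = 3%N -> (1 < count f l)%N = b -> (1 < count g l)%N = ~~ b ->
  exists2 y, y \in l & f y = b /\ g y = ~~ b.
Proof.
case: l => [|p [|q [|r [|? ?]]]] //= _.
have [pl ql rl] : [/\ p \in [:: p; q; r], q \in [:: p; q; r] &
  r \in [:: p; q; r]] by rewrite !inE !eqxx !orbT.
case: b; case fp: (f p); case fq: (f q); case fr: (f r) => //=;
  case gp: (g p); case gq: (g q); case gr: (g r) => //= _ _;
  by [exists p|exists q|exists r].
Qed.

(* A vertex can flip at step k + 1 only if an A-site next to it has just changed,
   which requires a flip at step k. *)
Lemma flips_link s b k x : flips s b k.+1 x ->
  exists2 y, flips s b k y & link s b k x y.
Proof.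
case: x => i j [xk xk1].
have [a [xa ak ak1]] : exists a,
    [/\ (i, j) \in up a, spinA s k a = b & spinA s k.+1 a = ~~ b].
  (* At most one A-site next to x has spin -b at step k, since x has spin b at step k + 1. Of two
     A-sites with spin -b at step k + 1, one has therefore just changed. *)
  have pick a c : (i, j) \in up a -> (i, j) \in up c -> a != c ->
      spinA s k.+1 a = ~~ b -> spinA s k.+1 c = ~~ b -> exists a,
      [/\ (i, j) \in up a, spinA s k a = b & spinA s k.+1 a = ~~ b].
    move=> ia ic ac ta tc; have [e|ne] := eqVneq (spinA s k a) b.
      by exists a.
    exists c; split=> //; apply: (spinB_one ia ic ac _ xk).
    by move: ne; case: (spinA s k a); case: b {xk xk1 ta tc}.
  case: (spinB_maj xk1) => -[]; apply: pick; geo.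
have [y ya fy] : exists2 y, y \in up a & flips s b k y.
  by apply: majority_change; rewrite // -spinAE.
exists y => //; exists a; split=> //.
by apply/eqP => xy; move: xk; rewrite xy fy.2 => /esym/bool_neqN.
Qed.

(** The list runs backwards in time, its entries flipping at steps k - 1, k - 2, and so on; the
    [False] branch keeps it from going past step 0. *)
Fixpoint chain s b k x ys {struct ys} : Prop := flips s b k x /\
  if ys is y :: ys' then
    if k is k'.+1 then link s b k' x y /\ chain s b k' y ys' else False
  else True.

Lemma chain_flips s b k x ys : chain s b k x ys -> flips s b k x.
Proof. by case: ys k => [|y ys] [|k] []. Qed.

Lemma chain_tail s b k x ys : chain s b k x ys ->
  {in ys, forall v, exists2 m, (m < k)%N & flips s b m v}.
Proof.
elim: ys k x => [|y ys IH] [|k] x //= [_] // [_ cy] v.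
rewrite inE => /predU1P[->|/(IH _ _ cy)[m mk fv]].
  by exists k => //; apply: chain_flips cy.
by exists m => //; apply: ltnW.
Qed.

Lemma chain_spin s b k x ys : chain s b k x ys ->
  {in ys, forall v, spinB s k v = ~~ b}.
Proof. by move=> /chain_tail cx v /cx[m mk /flips_spin_after]; apply. Qed.

Lemma chain_spin0 s b k x ys : chain s b k x ys ->
  {in x :: ys, forall v, spinB s 0 v = b}.
Proof.
move=> cx v; rewrite inE => /predU1P[->|/(chain_tail cx)[m _ /flips_spin_before]].
  exact: (flips_spin_before (chain_flips cx)).
by apply.
Qed.

Lemma chain_notin s b k x ys : chain s b k x ys -> x \notin ys.
Proof.
move=> cx; apply/negP => /(chain_spin cx).
by rewrite (chain_flips cx).1 => /bool_neqN.
Qed.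

(** Equal or adjacent on the triangular lattice: the list consists of the A-sites next to u. *)
Definition joined (u v : vertex) : bool :=
  has (fun a => v \in up a) [:: u; (u.1 - 1, u.2); (u.1, u.2 - 1)].

Lemma joinedP u v : reflect (exists2 a, u \in up a & v \in up a) (joined u v).
Proof.
apply: (iffP hasP) => -[a ua va]; exists a => //; case: u ua {va} => i j;
  by rewrite ?mem_up // -mem_up.
Qed.

(* When v flips, only one of its three A-sites still carries the spin b: the one
   leading to its successor y. If x were joined to v through that A-site, this
   A-site would see the spin b at both x and y and could not change after v
   flips. *)
Lemma chain_not_joined s b k x y ys : chain s b k y ys ->
  (forall m, (m <= k)%N -> spinB s m x = b) -> x \notin y :: ys ->
  {in ys, forall v, ~~ joined x v}.
Proof.
elim: ys k y => [|v ys IH] [|k] y // cy xb; first by case: cy.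
have [_ [[a [ya va yv ak ak1]] cv]] := cy.
rewrite !inE !negb_or => /and3P[xy xv xys] w.
rewrite inE => /predU1P[->|]; last first.
  apply: IH cv _ _ _ => [m mk|]; first by apply: xb; apply: ltnW.
  by rewrite inE negb_or xv.
apply/joinedP => -[g xg vg]; have [vk vk1] := chain_flips cv.
have gk : spinA s k g = b by apply: spinA_two xg vg xv (xb _ _) vk.
have ga : g = a.
  apply: contra_eq vk1 => ga; rewrite (spinB_two vg va ga gk ak).
  exact/eqP/bool_neqN.
move: ak1; rewrite -ga (spinA_two _ _ xy (xb _ _) (chain_flips cy).1) //.
  exact: bool_neqN.
by rewrite ga.
Qed.

(** * Paths on the triangular lattice *)

(** Rotation by 60 degrees, to the left if l holds, in lattice coordinates where (1, 0) and (0, 1)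
    form an angle of 60 degrees. *)
Definition rot (l : bool) (u : vertex) : vertex :=
  if l then (- u.2, u.1 + u.2) else (u.1 + u.2, - u.1).
(** Each class is an orbit of the rotation by 120 degrees, so a turn by 60 degrees exchanges the two
    classes. *)
Definition dirs (e : bool) : seq vertex :=
  if e then [:: (0, 1); (- 1, 0); (1, - 1)]
  else [:: (1, 0); (- 1, 1); (0, - 1)].

(* An edge (x, u, e) leaves x in direction u; e tells on which side of the edge
   its down triangle lies, i.e. whether the third vertex [apex] of this triangle
   is on the left. *)
Definition edge : Type := (vertex * vertex * bool)%type.
Definition tail (z : edge) : vertex := z.1.1.
Definition head (z : edge) : vertex := (z.1.1.1 + z.1.2.1, z.1.1.2 + z.1.2.2).
Definition apex (z : edge) : vertex :=
  (z.1.1.1 + (rot z.2 z.1.2).1, z.1.1.2 + (rot z.2 z.1.2).2).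
Definition valid (z : edge) : bool := z.1.2 \in dirs z.2.

(* A path goes straight on (None) or turns by 60 degrees, towards the apex of the
   current edge (Some true) or away from it (Some false). *)
Definition turn (z : edge) (c : option bool) : edge :=
  if c is Some t then (head z, rot (t == z.2) z.1.2, ~~ z.2)
  else (head z, z.1.2, z.2).

Definition edges_at (x : vertex) : seq edge :=
  [seq (x, u, e) | e <- [:: true; false], u <- dirs e].

Lemma mem_edges_at z : valid z -> z \in edges_at (tail z).
Proof.
case: z => [[x u] e] uz; apply/allpairsPdep; exists e, u; split=> //.
by case: e {uz}.
Qed.

Lemma valid_turn z c : valid z -> valid (turn z c).
Proof.
case: z => [[x u] e]; rewrite /valid /=.
by case: e => /=; rewrite !inE => /or3P[]/eqP->; case: c => [[]|].
Qed.

Lemma joined_edge x y : joined x y -> x != y ->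
  exists2 z, valid z /\ tail z = x & head z = y.
Proof.
case: x y => [i j] [p q] /joinedP[[a1 a2]].
rewrite /up !inE !xpair_eqE /= => ia pa ne.
have : (p - i, q - j) \in dirs true ++ dirs false.
  by rewrite /= !inE !xpair_eqE; lia.
by rewrite mem_cat => /orP[]h;
  [exists ((i, j), (p - i, q - j), true)|exists ((i, j), (p - i, q - j), false)];
  rewrite // /head /= !subrKC.
Qed.

Definition steps : seq vertex := (0, 0) :: dirs true ++ dirs false.

Lemma joinedE x y : joined x y = ((y.1 - x.1, y.2 - x.2) \in steps).
Proof.
case: x y => [i j] [p q]; rewrite /joined /up /= !inE !xpair_eqE /=.
by apply/idP/idP => h; lia.
Qed.

(** A step back or a turn by 120 degrees would end at the tail of z or next to it. *)
Lemma turn_exists z z' : valid z -> valid z' -> tail z' = head z ->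
  ~~ joined (tail z) (head z') -> exists c, z' = turn z c.
Proof.
case: z z' => [[[i j] u] e] [[[p q] u'] e']; rewrite /valid /tail /head /=.
move=> uz uz' [-> ->]; rewrite joinedE /=.
rewrite !(addrAC _ _ (- _)) !subrr !add0r.
by case: e uz; case: e' uz'; rewrite !inE => /or3P[]/eqP-> /or3P[]/eqP-> //= _;
  first [by exists None | by exists (Some true) | by exists (Some false)].
Qed.

Fixpoint heads (z : edge) (l : seq (option bool)) : seq vertex :=
  head z :: if l is c :: l' then heads (turn z c) l' else [::].

Lemma link_edge s b k x y : link s b k x y ->
  exists2 z, valid z /\ tail z = x & head z = y.
Proof.
by case=> a [xa ya xy _ _]; apply: joined_edge => //; apply/joinedP; exists a.
Qed.

Lemma three_cover (T : eqType) (l : seq T) (x y z : T) : size l = 3%N ->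
  uniq [:: x; y; z] -> x \in l -> y \in l -> z \in l ->
  {subset l <= [:: x; y; z]}.
Proof.
move=> sl un xl yl zl.
have [|_ e v] := uniq_min_size un _ (eq_leq sl); last by rewrite e.
by move=> v; rewrite !inE => /or3P[]/eqP->.
Qed.

(** [behead] exempts the successor of x, the only later vertex of an induced path that x may be
    joined to. *)
Fixpoint induced (l : seq vertex) : bool :=
  if l is x :: ys then
    [&& x \notin ys, all (fun y => ~~ joined x y) (behead ys) & induced ys]
  else true.

Lemma chain_induced s b k x ys : chain s b k x ys -> induced (x :: ys).
Proof.
elim: ys k x => [|y ys IH] k x cx; first by [].
apply/and3P; split; first exact: chain_notin cx.
  case: k cx => [[]//|k] cx; have [fx [_ cy]] := cx.
  apply/allP => v vys; apply: chain_not_joined cy _ _ v vys.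
    by move=> m mk; apply: flips_spin_before fx m (leqW mk).
  exact: chain_notin cx.
by case: k cx => [[]//|k [_ [_ /IH]]].
Qed.

Lemma headsE z l : exists ys, heads z l = head z :: ys.
Proof. by case: l => [|? ?]; eexists. Qed.

Lemma chain_exists s b n k x : flips s b (k + n.+1) x -> exists z l,
  [/\ valid z, tail z = x, size l = n & chain s b (k + n.+1) x (heads z l)].
Proof.
elim: n x => [|n IHn] x; rewrite addnS => fx.
  have [y fy xy] := flips_link fx; have [z [vz tz] hz] := link_edge xy.
  exists z, [::]; split=> //; rewrite /= hz.
  exact: (conj fx (conj xy (conj fy I))).
have [y fy xy] := flips_link fx; have [z [vz tz] hz] := link_edge xy.
have [z' [l [vz' tz' sl cy]]] := IHn y fy.
have cx : chain s b (k + n.+1).+1 x (y :: heads z' l).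
  exact: (conj fx (conj xy cy)).
have [ys hl] := headsE z' l.
have [c zc] : exists c, z' = turn z c.
  apply: turn_exists; rewrite ?tz ?hz //.
  by have /and3P[_ + _] := chain_induced cx; rewrite hl => /andP[].
exists z, (c :: l); split=> //=; first by rewrite sl.
by rewrite hz -zc.
Qed.

(** * Apexes along a path *)

Lemma apex_down z : valid z -> exists a,
  [/\ tail z \in down a, head z \in down a, apex z \in down a &
      uniq [:: tail z; head z; apex z]].
Proof.
case: z => [[[i j] u] e]; rewrite /valid /tail /head /apex /rot /down /=.
case: e; rewrite !inE => /or3P[]/eqP->.
- by exists (i - 1, j); split; rewrite /= ?inE ?xpair_eqE /=; lia.
- by exists (i - 1, j - 1); split; rewrite /= ?inE ?xpair_eqE /=; lia.
- by exists (i, j - 1); split; rewrite /= ?inE ?xpair_eqE /=; lia.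
- by exists (i, j - 1); split; rewrite /= ?inE ?xpair_eqE /=; lia.
- by exists (i - 1, j); split; rewrite /= ?inE ?xpair_eqE /=; lia.
- by exists (i - 1, j - 1); split; rewrite /= ?inE ?xpair_eqE /=; lia.
Qed.

Lemma apex_spin s b k z : valid z -> flips s b k (tail z) ->
  spinB s 0 (head z) = b -> spinB s 0 (apex z) = ~~ b.
Proof.
move=> vz ft hb; have [a [ta ha da un]] := apex_down vz.
have [dz|] := eqVneq (spinB s 0 (apex z)) b; last first.
  by case: b {ft hb}; case: (spinB _ _ _).
have cov : {subset down a <= [:: tail z; head z; apex z]} by apply: three_cover.
case: (flips_not_down (m := 0) ft ta) => u /cov; rewrite !inE => /or3P[]/eqP-> //.
exact: flips_spin_before ft _ (leq0n _).
Qed.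

Lemma apex_turn z c : valid z -> apex z != apex (turn z c).
Proof.
case: z => [[[i j] u] e]; rewrite /valid /apex /rot /=.
case: e; rewrite !inE => /or3P[]/eqP->; case: c => [[]|] /=;
  by rewrite !xpair_eqE /=; lia.
Qed.

(** Both turns go to the same side, around the apex of z: the edge in between has its own apex on
    the opposite side, so the second turn counts as away. *)
Lemma apex_turn2 z c c' : valid z -> apex z = apex (turn (turn z c) c') ->
  c = Some true /\ c' = Some false.
Proof.
case: z => [[[i j] u] e]; rewrite /valid /tail /head /apex /rot /=.
by case: e; rewrite !inE => /or3P[]/eqP->; case: c => [[]|];
  case: c' => [[]|] //=; move=> []; lia.
Qed.

(** The three down triangles at a vertex have as opposite sides alternate edges of the hexagon
    around it, and any two of these have equal or adjacent endpoints. *)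
Lemma apex_not_joined z z' : valid z -> valid z' ->
  ~~ joined (tail z) (tail z') -> ~~ joined (tail z) (head z') ->
  ~~ joined (head z) (tail z') -> ~~ joined (head z) (head z') ->
  apex z != apex z'.
Proof.
case: z z' => [[[i j] u] e] [[[p q] u'] e'].
rewrite /valid !joinedE /tail /head /apex /= => vz vz'.
rewrite !opprD !addrA !(addrAC _ _ (- i)) !(addrAC _ _ (- j)).
move=> tt th ht hh; apply/eqP => -[e1 e2]; move: vz vz' tt th ht hh.
(* Equal apexes express the difference of the tails by the directions, which leaves finitely many
   cases. *)
have -> : p - i = (rot e u).1 - (rot e' u').1 by lia.
have -> : q - j = (rot e u).2 - (rot e' u').2 by lia.
clear e1 e2.
by case: e; case: e'; rewrite !inE => /or3P[]/eqP-> /or3P[]/eqP->.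
Qed.

Lemma tail_turn z c : tail (turn z c) = head z.
Proof. by case: c. Qed.

(* After a turn towards the apex, a turn away from the next apex leads to an edge
   having the same apex as two edges before; such a repetition is skipped. *)
Fixpoint apexes (t : bool) (z : edge) (l : seq (option bool)) : seq vertex :=
  if l is c :: l' then
    (if t && (c == Some false) then [::] else [:: apex (turn z c)]) ++
      apexes (c == Some true) (turn z c) l'
  else [::].

Lemma apex_notin_far z0 z t l : valid z0 -> valid z ->
  all (fun v => ~~ joined (tail z0) v) (tail z :: heads z l) ->
  all (fun v => ~~ joined (head z0) v) (tail z :: heads z l) ->
  apex z0 \notin apex z :: apexes t z l.
Proof.
move=> v0; elim: l z t => [|c l IH] z t vz.
  rewrite /= !andbT => /andP[tt th] /andP[ht hh].
  by rewrite mem_seq1 apex_not_joined.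
move=> /= /andP[tt tl] /andP[ht hl].
have [/andP[th _] /andP[hh _]] := (tl, hl).
have {}IH u : apex z0 \notin apex (turn z c) :: apexes u (turn z c) l.
  by apply: IH; rewrite ?tail_turn //; apply: valid_turn.
rewrite inE negb_or apex_not_joined //=; case: ifP => _; last by apply: IH.
by have := IH (c == Some true); rewrite inE negb_or => /andP[].
Qed.

(** The next two edges are handled by [apex_turn] and [apex_turn2]; all later edges have both ends
    too far from z to share its apex. *)
Lemma apex_notin z t l : valid z -> induced (tail z :: heads z l) ->
  apex z \notin apexes t z l.
Proof.
move=> vz; case: l => [//|c l] ind; rewrite mem_cat negb_or.
have -> /= : apex z \notin (if t && (c == Some false) then [::]
    else [:: apex (turn z c)]).
  by case: ifP => // _; rewrite mem_seq1 apex_turn.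
case: l ind => [//|c' l] ind; rewrite mem_cat negb_or.
have -> /= : apex z \notin (if (c == Some true) && (c' == Some false) then [::]
    else [:: apex (turn (turn z c) c')]).
  case: ifP => // ct; rewrite mem_seq1; apply: contraFneq ct.
  by case/(apex_turn2 vz) => -> ->.
case: l ind => [//|c'' l] /and3P[_ /= /andP[_ tl] /and3P[_ hl _]].
have := @apex_notin_far z (turn (turn (turn z c) c') c'') (c'' == Some true) l.
rewrite !tail_turn => /(_ vz (valid_turn _ (valid_turn _ (valid_turn _ vz))) tl hl).
by case: ifP => // _; rewrite inE negb_or => /andP[].
Qed.

Lemma apexes_uniq z t l : valid z -> induced (tail z :: heads z l) ->
  uniq (apexes t z l).
Proof.
elim: l z t => [//|c l IH] z t vz /and3P[_ _]; rewrite -(tail_turn z c) => ind.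
have vz' := valid_turn c vz; have {}IH := IH _ (c == Some true) vz' ind.
have := apex_notin (c == Some true) vz' ind.
by rewrite /=; case: ifP => //= _ ->.
Qed.

Lemma chain_apexes s b k z t l : valid z -> chain s b k (tail z) (heads z l) ->
  {in apex z :: apexes t z l, forall d, spinB s 0 d = ~~ b}.
Proof.
move=> vz cz d; rewrite inE => /predU1P[->|].
  apply: (apex_spin vz (chain_flips cz)); apply: (chain_spin0 cz).
  by have [ys ->] := headsE z l; rewrite !inE eqxx orbT.
elim: l z k t vz cz => [//|c l IH] z [|k] t vz cz; first by case: cz.
have {}cz : chain s b k (tail (turn z c)) (heads (turn z c) l).
  by rewrite tail_turn; have [_ [_]] := cz.
have vz' := valid_turn c vz.
rewrite mem_cat => /orP[|]; last exact: (IH _ k).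
case: ifP => // _; rewrite mem_seq1 => /eqP->.
apply: (apex_spin vz' (chain_flips cz)); apply: (chain_spin0 cz).
by have [ys ->] := headsE (turn z c) l; rewrite !inE eqxx orbT.
Qed.

(** * Initial patterns forced by a flip *)

Definition path_sites (z : edge) (l : seq (option bool)) : seq vertex :=
  tail z :: heads z l.
(** The flag starts as [false], since no turn precedes the first edge. *)
Definition path_apexes (z : edge) (l : seq (option bool)) : seq vertex :=
  apex z :: apexes false z l.

(** Distinctness is included so that independence turns the probability into a product. *)
Definition pattern (s : config) (b : bool) (X Y : seq vertex) : Prop :=
  [/\ uniq (X ++ Y), {in X, forall v, s (false, v.1, v.2) = b} &
      {in Y, forall v, s (false, v.1, v.2) = ~~ b}].

Lemma induced_uniq l : induced l -> uniq l.
Proof. by elim: l => //= x l IH /and3P[-> _ /IH]. Qed.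

Lemma flips_pattern s b k n x : flips s b k x -> (n < k)%N ->
  exists2 z, z \in edges_at x &
  exists2 l, size l = n & pattern s b (path_sites z l) (path_apexes z l).
Proof.
move=> fx /subnK nk; move: fx; rewrite -nk.
case/chain_exists => z [l [vz <- sl cz]].
exists z; first exact: mem_edges_at.
have ind := chain_induced cz; exists l => //.
have sX := chain_spin0 cz; have sY := chain_apexes (t := false) vz cz.
split=> //; rewrite cat_uniq; apply/and3P; split; first exact: induced_uniq.
  (* Sites and apexes are disjoint because their initial spins differ. *)
  apply/hasPn => v /sY vb; apply/negP => /sX.
  by rewrite vb => /esym/bool_neqN.
by rewrite /= apex_notin //= apexes_uniq.
Qed.

Lemma size_heads z l : size (heads z l) = (size l).+1.
Proof. by elim: l z => //= c l IH z; rewrite IH. Qed.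

(** The number of apexes besides the first one, which depends on the turns only. *)
Fixpoint turns_cost (t : bool) (l : seq (option bool)) : nat :=
  if l is c :: l' then
    (~~ (t && (c == Some false)) + turns_cost (c == Some true) l')%N
  else 0%N.

Lemma size_apexes t z l : size (apexes t z l) = turns_cost t l.
Proof.
by elim: l t z => //= c l IH t z; rewrite size_cat IH; case: ifP.
Qed.

(** * Flips, patterns and convergence *)

Definition near_vertices (x : site) : seq vertex :=
  let: (c, i, j) := x in if c then up (i, j) else [:: (i, j)].

(** A flip of an A-site needs a flip of a neighbour since its previous update; [0 < n] excludes time
    1, which has no previous update. A flip at step k acts at time 2k + 2 on B and at time 2k + 3 on
    A. *)
Lemma flips_after_vertex n s x : (0 < n)%N -> flips_after n x s ->
  exists2 v, v \in near_vertices x &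
  exists k b, (n <= k.*2.+2)%N /\ flips s b k v.
Proof.
move=> n0 [[|m] [nm]] //=; rewrite -[X in X != _]/(sync s m.+1 x) => xm.
have [k [mk|mk]] : exists k, m = k.*2 \/ m = k.*2.+1.
- exists m./2; have := odd_double_half m.
  by case: (odd m) => e; [right|left]; rewrite -[LHS]e.
- case: x xm => [[[] i] j]; rewrite {}mk in nm *; last first.
    by rewrite (syncB_odd s k (i, j)) eqxx.
  case: k nm => [|k] nm; first by case: n n0 nm.
  rewrite (syncA_even s k (i, j)) -[X in X != _]/(spinA s k.+1 (i, j)) => ak.
  have [y yu fy] : exists2 y, y \in up (i, j) &
      flips s (spinA s k (i, j)) k y.
    apply: majority_change; rewrite // -spinAE //.
    by move: ak; do 2![case: (spinA _ _ _)].
  by exists y => //; exists k, (spinA s k (i, j)).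
- case: x xm => [[[] i] j]; rewrite {}mk in nm *.
    by rewrite -doubleS (syncA_even s k (i, j)) eqxx.
  rewrite -doubleS (syncB_odd s k (i, j)) -[X in X != _]/(spinB s k.+1 (i, j)).
  move=> bk; exists (i, j); first by rewrite inE.
  exists k, (spinB s k (i, j)); split; first exact: ltnW.
  by split=> //; move: bk; do 2![case: (spinB _ _ _)].
Qed.

Lemma spinB_eventually s v : exists N, forall k, (N <= k)%N ->
  spinB s k v = spinB s N v.
Proof.
have [[k vk]|nof] := pselect (exists k, spinB s k v != spinB s k.+1 v).
  by exists k.+1; apply: flip_stable.
exists 0%N => k _; elim: k => // k IH; rewrite -IH; apply/esym/eqP.
by apply: contra_notT nof => vk; exists k.
Qed.

Lemma spinA_eventually s a : exists N, forall k, (N <= k)%N ->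
  spinA s k a = spinA s N a.
Proof.
have [N1 h1] := spinB_eventually s a.
have [N2 h2] := spinB_eventually s (a.1 + 1, a.2).
have [N3 h3] := spinB_eventually s (a.1, a.2 + 1).
exists (N1 + N2 + N3)%N => k kN; rewrite !spinAE /=.
by rewrite (h1 k) ?(h2 k) ?(h3 k) ?(h1 (_ + _)%N) ?(h2 (_ + _)%N)
  ?(h3 (_ + _)%N) //; lia.
Qed.

Lemma sync_eventually s x : exists N, forall n, (N <= n)%N ->
  sync s n x = sync s N x.
Proof.
case: x => [[[] i] j].
- have [N h] := spinA_eventually s (i, j).
  exists N.*2.+1 => -[//|n] nN; rewrite !(sync_spinA s _ (i, j)).
  by rewrite doubleK h // -(doubleK N) half_leq.
- have [N h] := spinB_eventually s (i, j).
  exists N.*2 => n nN; rewrite !(sync_spinB s _ (i, j)).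
  by rewrite doubleK h // -(doubleK N) half_leq.
Qed.

(** The pointwise topology is the supremum of those induced by the evaluations, which are surjective
    because of the constant functions. *)
Lemma cvg_ptws (U : Type) (V : uniformType) (u : nat -> U -> V) (f : U -> V) :
  (forall x, u n x @[n --> \oo] --> f x) ->
  (u n : {ptws U -> V}) @[n --> \oo] --> (f : {ptws U -> V}).
Proof.
move=> uf; apply/cvg_sup => i.
rewrite cvg_image; last by rewrite eqEsubset; split=> v // _; exists (cst v).
move=> W /(uf i) /= Wi; exists (@^~ i @^-1` W) => //.
by rewrite eqEsubset; split => [j [? + <-//]|j Wj]; exists (fun _ => j).
Qed.

Lemma sync_cvg (s : config) :
  (sync s n : {ptws site -> bool}) @[n --> \oo] -->
    (sync_infty s : {ptws site -> bool}).
Proof.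
apply: cvg_ptws => x; have [N h] := sync_eventually s x.
have near_N : \forall n \near \oo, sync s n x = sync s N x.
  by exists N => // n /=; apply: h.
rewrite /sync_infty (lim_near_cst _ near_N); last exact: discrete_hausdorff.
exact: cvg_near_cst near_N.
Qed.

(** The down triangle at this position contains x if x is in B, and two neighbours of x if x is in
    A; when constant initially, it keeps x from flipping after time 1. *)
Definition witness (x : site) : vertex :=
  let: (c, i, j) := x in if c then (i, j) else (i - 1, j).

Lemma down_not_flips_after n s x b : (0 < n)%N ->
  {in down (witness x), forall v, s (false, v.1, v.2) = b} ->
  ~ flips_after n x s.
Proof.
move=> n0 dn [[|m] [nm]] //; rewrite -[m.+1.-1]/m.
have st k : {in down (witness x), forall v, spinB s k v = b}.
  exact: (@down_stable s 0).
case: x dn st => [[[] i] j]; rewrite /witness => dn st.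
  case: m nm => [|m] nm; first by case: n n0 nm.
  have stA k : spinA s k (i, j) = b.
    by apply: (@spinA_two s k _ b (i + 1, j) (i, j + 1)); rewrite ?st //; geo.
  by rewrite !(sync_spinA s _ (i, j)) !stA eqxx.
by rewrite !(sync_spinB s _ (i, j)) !st ?eqxx //; geo.
Qed.

(** * Probability estimates *)

Definition turn_codes : seq (option bool) := [:: None; Some true; Some false].

Fixpoint words (n : nat) : seq (seq (option bool)) :=
  if n is m.+1 then [seq c :: l | c <- turn_codes, l <- words m]
  else [:: [::]].

Lemma mem_words l : l \in words (size l).
Proof.
elim: l => [//|c l IH]; apply/allpairsP; exists (c, l); split=> //.
by case: c => [[]|].
Qed.

(* The weights 1 and 3/2 are a supersolution, with growth rate 7/8 for all p, of
   the two-state recursion satisfied by these sums. *)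
Lemma words_sum (R : realFieldType) (p q : R) t n : 0 <= p -> 0 <= q ->
  p + q = 1 ->
  \sum_(l <- words n) p ^+ size l * q ^+ turns_cost t l <=
    (if t then 3 / 2 else 1) * (7 / 8) ^+ n.
Proof.
move=> p0 q0 pq; elim: n t => [|n IH] t.
  by rewrite /= big_seq1 /= !mulr1; case: t; lra.
have step c :
    \sum_(l <- words n) p ^+ size (c :: l) * q ^+ turns_cost t (c :: l) =
    p * q ^+ (~~ (t && (c == Some false))) *
      \sum_(l <- words n) p ^+ size l * q ^+ turns_cost (c == Some true) l.
  rewrite big_distrr /=; apply: eq_bigr => l _.
  by rewrite exprS exprD mulrACA.
rewrite [words _]/= !big_cat !big_map /= big_nil !step /= !andbF !andbT addr0.
have := IH true; have := IH false; rewrite /= !expr1 (exprS (7 / 8)).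
set S0 := \sum_(l <- _) _; set S1 := \sum_(l <- _) _; set r := _ ^+ n => h0 h1.
have r0 : 0 <= r by apply: exprn_ge0; lra.
have -> : q = 1 - p by lra.
have p1 : p <= 1 by lra.
have pq4 : p * (1 - p) <= 1 / 4 by have := sqr_ge0 (p - 1 / 2); lra.
have pq0 : 0 <= p * (1 - p) by apply: mulr_ge0; lra.
clear step IH; case: t => /=; rewrite ?expr0 ?expr1.
- have e0 : p * (1 - p) * S0 <= p * (1 - p) * (1 * r) by exact: ler_wpM2l.
  have e1 : p * (1 - p) * S1 <= p * (1 - p) * (3 / 2 * r) by exact: ler_wpM2l.
  have e2 : p * S0 <= p * (1 * r) by exact: ler_wpM2l.
  (* The bound 21/16 is 3/2 times 7/8; the quadratic in p has its maximum 49/40 at p = 7/10. *)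
  have e3 : (p + 5 / 2 * (p * (1 - p))) * r <= 21 / 16 * r.
    by apply: ler_wpM2r => //; have := sqr_ge0 (p - 7 / 10); lra.
  lra.
(* The three turns contribute pq (1 + 3/2 + 1) = 7pq/2, at most 7/8. *)
- have e0 : p * (1 - p) * S0 <= p * (1 - p) * (1 * r) by exact: ler_wpM2l.
  have e1 : p * (1 - p) * S1 <= p * (1 - p) * (3 / 2 * r) by exact: ler_wpM2l.
  have e3 : (p * (1 - p)) * r <= 1 / 4 * r by exact: ler_wpM2r.
  lra.
Qed.

(** For large n, the constant C is absorbed by N of the factors r; the finitely many other n > 0 are
    covered by y <= r, at the price of a smaller c. *)
Lemma decay_rate (R : realType) (C r : R) : 0 < r < 1 -> exists2 c : R, 0 < c &
  forall (n : nat) (y : R), (n == 0%N -> y <= 1) -> ((0 < n)%N -> y <= r) ->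
    y <= C * r ^+ n./2 -> y <= expR (- (c * n%:R)).
Proof.
move=> /andP[r0 r1].
have [N CN] : exists N, C * r ^+ N <= 1.
  have := @cvg_geometric R C r; rewrite ger0_norm ?ltW // => /(_ r1).
  move=> /cvgrPdist_le /(_ 1 ltr01)[N _ /(_ N (leqnn N))].
  rewrite /= sub0r normrN => h; exists N; exact: le_trans (ler_norm _) h.
(* This choice gives [n <= 4 * (n./2 - N)] for all n > M. *)
pose M := (4 * N + 4)%N.
have M0 : 0 < M%:R :> R by rewrite ltr0n /M addn4.
have lnr : ln r < 0 by apply: ln_lt0; rewrite r0 r1.
exists (- ln r / M%:R) => [|n y h0 h1 h2].
  by rewrite divr_gt0 // oppr_gt0.
have key k : (n <= k * M)%N -> r ^+ k <= expR (- (- ln r / M%:R * n%:R)).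
  move=> nk; rewrite -[X in X ^+ _](lnK _) ?posrE // -expRM_natl ler_expR.
  have -> : - (- ln r / M%:R * n%:R) = n%:R / M%:R * ln r by ring.
  apply: ler_wnM2r; first exact: ltW.
  by rewrite ler_pdivrMr // -natrM ler_nat.
have [n0|n0] := posnP n; first by rewrite n0 mulr0 oppr0 expR0 h0 // n0.
have [nM|Mn] := leqP n M.
  by apply: le_trans (h1 n0) _; rewrite -[r]expr1 key // mul1n.
have Nn : (N <= n./2)%N by rewrite /M in Mn; lia.
apply: le_trans h2 _; apply: (@le_trans _ _ (r ^+ (n./2 - N))); last first.
  apply: key; apply: leq_trans (leq_mul (leqnn _) (leq_addl (4 * N) 4)).
  by rewrite /M in Mn; lia.
rewrite -{1}(subnK Nn) exprD mulrCA ler_piMr // exprn_ge0 // ltW //.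
Qed.

(** * Measurability and union bounds *)

Lemma measurable_sync d (T : measurableType d) (sigma : site -> T -> bool) n x :
  (forall y, measurable_fun setT (sigma y)) ->
  measurable_fun setT (fun w => sync (sigma^~ w) n x).
Proof.
move=> ms; elim: n x => [|n IH] x; first exact: ms.
have count3 (f g h : T -> bool) : measurable_fun setT f ->
    measurable_fun setT g -> measurable_fun setT h ->
    measurable_fun setT (fun w => (1 < f w + (g w + (h w + 0)))%N).
  move=> mf mg mh; rewrite (_ : (fun w => _) =
    (fun w => (f w && g w) || (g w && h w) || (h w && f w))).
    by do ?[apply: measurable_or | apply: measurable_and].
  by apply/funext => w; case: (f w); case: (g w); case: (h w).
rewrite (_ : (fun w => _) = if x.1.1 == ~~ odd n
    then fun w => (1 < count (sync (sigma^~ w) n) (neighbors x))%N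
    else fun w => sync (sigma^~ w) n x); last first.
  by apply/funext => w; rewrite syncS update_majority; case: ifP.
case: ifP => _; last exact: IH.
by case: x => [[[] i] j]; apply: count3.
Qed.

Lemma measurable_flips_after d (T : measurableType d)
    (sigma : site -> T -> bool) n x :
  (forall y, measurable_fun setT (sigma y)) ->
  measurable [set w | flips_after n x (sigma^~ w)].
Proof.
move=> ms; rewrite (_ : [set w | _] = \bigcup_(m in [set m | (n < m)%N])
  [set w | sync (sigma^~ w) m x != sync (sigma^~ w) m.-1 x]); last first.
  apply/seteqP; split=> w /=; first by case=> m [nm h]; exists m.
  by case=> m nm h; exists m.
apply: bigcup_measurable => m _.
have mx k := measurable_sync k x ms.
have mneq : measurable_fun setT (fun w => (sync (sigma^~ w) m x &&
    ~~ sync (sigma^~ w) m.-1 x) || (sync (sigma^~ w) m.-1 x &&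
    ~~ sync (sigma^~ w) m x)).
  apply: measurable_or; apply: measurable_and; rewrite //; exact: measurable_neg.
have := mneq measurableT [set true] I; rewrite setTI.
congr measurable; apply/seteqP; split=> w /=;
  by do 2!case: (sync _ _ _).
Qed.

Lemma union_bound d (T : measurableType d) (R : realType)
    (P : probability T R) (I : eqType) (s : seq I) (F : I -> set T)
    (c : I -> R) :
  {in s, forall i, measurable (F i) /\ (P (F i) <= (c i)%:E)%E} ->
  measurable (\big[setU/set0]_(i <- s) F i) /\
  (P (\big[setU/set0]_(i <- s) F i) <= (\sum_(i <- s) c i)%:E)%E.
Proof.
elim: s => [|i s IH] h; first by rewrite !big_nil measure0; split.
have [mi ci] := h i (mem_head _ _).
have [|ms cs] := IH; first by move=> j js; apply: h; rewrite inE js orbT.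
rewrite !big_cons; split; first exact: measurableU.
by apply: le_trans (measureU2 _ mi ms) _; rewrite EFinD leeD.
Qed.

(** * Patterns of independent spins *)

Section Independent.
Context d (T : measurableType d) (R : realType) (P : probability T R).
Variables (lambda : R) (sigma : site -> {RV P >-> bool}).
Hypothesis iid : iid_spins lambda sigma.

Definition density (b : bool) : R := if b then lambda else 1 - lambda.

Definition bsite (v : vertex) : site := (false, v.1, v.2).

Lemma bsite_inj : injective bsite.
Proof. by case=> ? ? [? ?] [-> ->]. Qed.

(** The value [set0] for lists with repetitions keeps the product bound valid for every word of
    turns, even if its path meets itself. *)
Definition pattern_event b (X Y : seq vertex) : set T :=
  if uniq (X ++ Y) then
    \bigcap_(i in [set` map bsite (X ++ Y)])
      (sigma i @^-1` [set if i \in map bsite X then b else ~~ b])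
  else set0.

Lemma pattern_eventP b X Y w : pattern (sigma^~ w) b X Y ->
  pattern_event b X Y w.
Proof.
case=> un hX hY; rewrite /pattern_event un => i /mapP[v vXY ->] /=.
rewrite (mem_map bsite_inj); case: ifP => vX; first exact: hX.
by apply: hY; move: vXY; rewrite mem_cat vX.
Qed.

Lemma measurable_pattern_event b X Y : measurable (pattern_event b X Y).
Proof.
rewrite /pattern_event; case: ifP => // _.
apply: fin_bigcap_measurable; first exact: finite_seq.
by move=> i _; rewrite -[X in measurable X]setTI; apply: measurable_funPT.
Qed.

Lemma density_ge0 b : 0 <= density b.
Proof.
have [_ /(_ (bsite (0, 0)))[h1 h0]] := iid.
by case: b; rewrite /= -lee_fin -?h1 -?h0 measure_ge0.
Qed.

Lemma prob_spin b x : P (sigma x @^-1` [set b]) = (density b)%:E.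
Proof. by have [_ /(_ x)[h1 h0]] := iid; case: b. Qed.

Lemma prod_EFin_const (I : eqType) (s : seq I) (F : I -> \bar R) (r : R) :
  {in s, forall i, F i = r%:E} -> (\prod_(i <- s) F i = (r ^+ size s)%:E)%E.
Proof.
elim: s => [|i s IH] h; first by rewrite big_nil expr0.
rewrite big_cons h ?mem_head // IH -?EFinM -?exprS // => j js.
by apply: h; rewrite inE js orbT.
Qed.

Lemma prob_pattern_eq b X Y : uniq (X ++ Y) -> P (pattern_event b X Y) =
  (density b ^+ size X * density (~~ b) ^+ size Y)%:E.
Proof.
move=> un; rewrite /pattern_event un; have [ind _] := iid.
rewrite (ind _ (fun i => [set if i \in map bsite X then b else ~~ b]));
  last by rewrite (map_inj_uniq bsite_inj).
rewrite map_cat big_cat /= EFinM; congr (_ * _)%E.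
  rewrite -(size_map bsite); apply: prod_EFin_const => i iX.
  by rewrite iX prob_spin.
rewrite -(size_map bsite); apply: prod_EFin_const => i /mapP[v vY ->].
rewrite (mem_map bsite_inj) prob_spin; case: ifP => // vX.
by move: un; rewrite cat_uniq => /and3P[_ /hasPn/(_ _ vY)]; rewrite /= vX.
Qed.

Lemma prob_pattern_le b X Y : (P (pattern_event b X Y) <=
  (density b ^+ size X * density (~~ b) ^+ size Y)%:E)%E.
Proof.
have [un|/negbTE un] := boolP (uniq (X ++ Y)).
  by rewrite prob_pattern_eq.
rewrite /pattern_event un measure0 lee_fin mulr_ge0 //;
  by apply: exprn_ge0; apply: density_ge0.
Qed.

End Independent.

Lemma union_bound_cst d (T : measurableType d) (R : realType)
    (P : probability T R) (I : eqType) (s : seq I) (F : I -> set T) (a : R) :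
  {in s, forall i, measurable (F i) /\ (P (F i) <= a%:E)%E} ->
  measurable (\big[setU/set0]_(i <- s) F i) /\
  (P (\big[setU/set0]_(i <- s) F i) <= (a *+ size s)%:E)%E.
Proof. by move=> /union_bound; rewrite big_const_seq count_predT iter_addr_0. Qed.

(** * Bounds on the probability of a late flip *)

Section Decay.
Context d (T : measurableType d) (R : realType) (P : probability T R).
Variables (lambda : R) (sigma : site -> {RV P >-> bool}).
Hypothesis iid : iid_spins lambda sigma.

Definition path_event (n : nat) (x : site) : set T :=
  \big[setU/set0]_(v <- near_vertices x) \big[setU/set0]_(b <- [:: true; false])
    \big[setU/set0]_(z <- edges_at v) \big[setU/set0]_(l <- words n)
      pattern_event sigma b (path_sites z l) (path_apexes z l).

Lemma mem_bigsetU (I : eqType) (s : seq I) (F : I -> set T) i w :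
  i \in s -> F i w -> (\big[setU/set0]_(j <- s) F j) w.
Proof.
move=> + Fi; elim: s => // j s IH; rewrite big_cons inE.
by case/predU1P => [<-|/IH]; [left|right].
Qed.

Lemma flips_after_path_event n x : (1 < n./2)%N ->
  [set w | flips_after n x (sigma^~ w)] `<=` path_event (n./2 - 2) x.
Proof.
move=> n1 w; have n0 : (0 < n)%N by case: n n1.
case/(flips_after_vertex n0) => v xv [k [b [nk fv]]].
(* From [n <= k.*2.+2] follows [n./2 - 1 <= k], hence [n./2 - 2 < k]. *)
have [|z zv [l sl pat]] := flips_pattern (n := n./2 - 2) fv; first by lia.
apply: (mem_bigsetU xv); apply: (@mem_bigsetU _ _ _ b); first by case: (b).
apply: (mem_bigsetU zv); apply: (@mem_bigsetU _ _ _ l).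
  by rewrite -sl mem_words.
exact: pattern_eventP.
Qed.

Lemma density_sum b : density lambda b + density lambda (~~ b) = 1.
Proof. by case: b; rewrite /= ?subrK // addrC subrK. Qed.

(** The factor 36 counts at most 3 vertices, 2 spins and 6 first edges. The tail, head and apex of
    the first edge contribute p^2 q, at most 1. *)
Lemma prob_path_event n x : measurable (path_event n x) /\
  (P (path_event n x) <= (36 * (7 / 8) ^+ n)%:E)%E.
Proof.
have r0 : 0 <= (7 / 8) ^+ n :> R by apply: exprn_ge0; lra.
have [v _|mx px] := @union_bound_cst _ _ _ P _ (near_vertices x)
    (fun v => \big[setU/set0]_(b <- [:: true; false])
    \big[setU/set0]_(z <- edges_at v) \big[setU/set0]_(l <- words n)
      pattern_event sigma b (path_sites z l) (path_apexes z l))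
    ((7 / 8) ^+ n *+ 6 *+ 2); last first.
  split=> //; apply: le_trans px _; rewrite lee_fin -!mulrnA.
  rewrite [leRHS]mulr_natl.
  by apply: ler_wpMn2l => //; case: (x) => [[[]]].
apply: (@union_bound_cst _ _ _ P _ [:: true; false]) => b _.
apply: (@union_bound_cst _ _ _ P _ (edges_at v)) => z _.
have [l _|ml pl] := @union_bound _ _ _ P _ (words n)
    (fun l => pattern_event sigma b (path_sites z l) (path_apexes z l))
    (fun l => density lambda b ^+ size (path_sites z l) *
       density lambda (~~ b) ^+ size (path_apexes z l)).
  split; first exact: measurable_pattern_event.
  exact: prob_pattern_le.
split=> //; apply: le_trans pl _; rewrite lee_fin.
have p0 := density_ge0 iid b; have q0 := density_ge0 iid (~~ b).
have pq := density_sum b.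
set p := density lambda b in p0 pq *; set q := density _ _ in q0 pq *.
rewrite (eq_bigr (fun l => p ^+ 2 * q *
    (p ^+ size l * q ^+ turns_cost false l))); last first.
  by move=> l _; rewrite /= size_heads size_apexes !exprS; ring.
rewrite -big_distrr /=.
apply: le_trans (_ : 1 * \sum_(l <- words n)
    p ^+ size l * q ^+ turns_cost false l <= _).
  apply: ler_wpM2r.
    by apply: sumr_ge0 => l _; apply: mulr_ge0; apply: exprn_ge0.
  have p1 : p <= 1 by lra.
  have q1 : q <= 1 by lra.
  by apply: mulr_ile1 => //; [apply: exprn_ge0|apply: exprn_ile1].
by rewrite mul1r; have := words_sum false n p0 q0 pq; rewrite mul1r.
Qed.

(** The factor (8/7)^2 makes up for the loss in [n./2 - 2]; for [n./2 < 2] the bound exceeds 1. *)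
Lemma prob_flips_after_le n x : (P [set w | flips_after n x (sigma^~ w)] <=
  (36 * (8 / 7) ^+ 2 * (7 / 8) ^+ n./2)%:E)%E.
Proof.
have mF : measurable [set w | flips_after n x (sigma^~ w)].
  by apply: measurable_flips_after => y; apply: measurable_funPT.
have [n1|n1] := leqP 2 n./2.
  have [mp pp] := prob_path_event (n./2 - 2) x.
  apply: le_trans (le_measure P _ _ (flips_after_path_event n1)) _.
  - by rewrite inE.
  - by rewrite inE.
  apply: le_trans pp _; rewrite lee_fin -{2}(subnK n1) exprD.
  by set r := _ ^+ (_ - _); lra.
apply: le_trans (probability_le1 P mF) _; rewrite lee_fin.
by case: n./2 n1 => [|[|]] // _; lra.
Qed.

Lemma prob_flips_after_le_7_8 n x : (0 < n)%N ->
  (P [set w | flips_after n x (sigma^~ w)] <= (7 / 8)%:E)%E.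
Proof.
move=> n0.
have mF : measurable [set w | flips_after n x (sigma^~ w)].
  by apply: measurable_flips_after => y; apply: measurable_funPT.
have [b hb] : exists b, 1 / 2 <= density lambda b.
  have := density_sum true; case: (lerP (1 / 2) (density lambda true)) => h e.
    by exists true.
  by exists false; rewrite /density /= in h e *; lra.
pose E := pattern_event sigma b (down (witness x)) [::].
have mE : measurable E by apply: measurable_pattern_event.
have un : uniq (down (witness x) ++ [::]).
  rewrite cats0; case: (witness x) => i j.
  by rewrite /down /= !inE !xpair_eqE /=; lia.
have sub : [set w | flips_after n x (sigma^~ w)] `<=` ~` E.
  move=> w /= fw; rewrite /E /pattern_event un => Ew.
  apply: (@down_not_flips_after n _ x b n0 _ fw) => v vd.
  have vd' : v \in down (witness x) ++ [::] by rewrite cats0.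
  by have := Ew (bsite v) (map_f _ vd'); rewrite (mem_map bsite_inj) vd.
have le_mu : (P [set w | flips_after n x (sigma^~ w)] <= P (~` E))%E.
  by apply: le_measure sub; rewrite inE //; apply: measurableC.
apply: le_trans le_mu _; rewrite probability_setC //.
rewrite (prob_pattern_eq iid) // -EFinD lee_fin /= expr0 mulr1.
have : (1 / 2) ^+ 3 <= density lambda b ^+ 3 by apply: lerXn2r; rewrite ?nnegrE; lra.
by rewrite [(1 / 2) ^+ 3]exprS expr2; lra.
Qed.

End Decay.

Theorem theorem3 (R : realType) (lambda : R) (hlambda : 0 <= lambda <= 1) :
  exists c : R, 0 < c /\
    forall (d : measure_display) (T : measurableType d) (P : probability T R)
      (sigma0 : site -> {RV P >-> bool}),
      iid_spins lambda sigma0 ->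
      {ae P, forall w,
        (sync (sigma0^~ w) n : {ptws site -> bool}) @[n --> \oo] -->
          (sync_infty (sigma0^~ w) : {ptws site -> bool})} /\
      forall n : nat,
        (forall x, subA x ->
          (P [set w | flips_after n x (sigma0^~ w)] <= (expR (- (c * n%:R)))%:E)%E) /\
        (forall x, subB x ->
          (P [set w | flips_after n x (sigma0^~ w)] <= (expR (- (c * n%:R)))%:E)%E).
Proof.
(* Both constants are free of [lambda], so one rate c serves all densities. *)
have [|c c0 hc] := @decay_rate R (36 * (8 / 7) ^+ 2) (7 / 8); first by lra.
exists c; split=> // d T P sigma0 iid.
split; first by apply: aeW => w; apply: sync_cvg.
move=> n; suff decay x : (P [set w | flips_after n x (sigma0^~ w)] <=
    (expR (- (c * n%:R)))%:E)%E by split=> x _.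
have mF : measurable [set w | flips_after n x (sigma0^~ w)].
  by apply: measurable_flips_after => y; apply: measurable_funPT.
have finF := fin_num_measure P _ mF.
rewrite -(fineK finF) lee_fin; apply: hc => [_|n0|]; rewrite -lee_fin fineK //.
- exact: probability_le1.
- exact: (prob_flips_after_le_7_8 iid x n0).
- exact: (prob_flips_after_le iid n x).
Qed.
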